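(* Let $A, B \subseteq H$ be non-empty sets with a common point $\bar{x} \in A \cap B$. Assume that $A$ and $B$ are locally closed at $\bar{x}$ and intersect transversally at $\bar{x}$ with $\cos(A,B,\bar{x}) = \bar{c} < 1$, and that $A$ is super-regular at $\bar{x}$. Then for every $c \in (\bar{c}, 1)$ there exists $\delta > 0$ such that for each $\sigma_A \geq 1$ satisfying $\kappa := \sigma_A \cdot c < 1$ and each $a_0 \in A$ satisfying $|a_0 - \bar{x}| < \frac{1 - \kappa}{8} \delta$, the quasioptimal alternating projections started at $a_0$ with constants $\sigma_A$ and $\sigma_B = 1$ converge to a point $\hat{x} \in A \cap B$ such that $|\hat{x} - \bar{x}| < \tfrac{3}{8} \delta$ and, for all $n \in \mathbb{N}_0$, $$|\hat{x} - a_n| \leq \frac{1 + \kappa}{1 - \kappa}\, \kappa^n \cdot \mathrm{dist}(a_0, B), \qquad |\hat{x} - b_{n+1}| \leq \frac{2 \kappa}{1 - \kappa}\, \kappa^{n} \cdot \mathrm{dist}(a_0, B).$$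
   Context: $H$ is a Euclidean space (finite-dimensional real inner product space) with inner product $\langle\cdot,\cdot\rangle$ and norm $|\cdot|$; $\mathbb{B}_r(x)$ is the open ball of radius $r$ centred at $x$, and $\overline{\mathbb{B}}$ is the closed unit ball at the origin. $\mathbb{N}_0=\{0,1,2,\dots\}$. A neighbourhood of a point is an open set containing it. For non-empty $A\subseteq H$ and $x\in H$: $\mathrm{dist}(x,A)=\inf_{a\in A}|x-a|$; the (optimal) metric projection is $\Pi_A(x)=\{a\in A: |x-a|=\mathrm{dist}(x,A)\}$; for $\sigma\ge 1$ the $\sigma$-quasioptimal metric projection is $\Pi_A(x;\sigma)=\{a\in A: |x-a|\le\sigma\cdot\mathrm{dist}(x,A)\}$ (so $\Pi_A(x;1)=\Pi_A(x)$). $A$ is locally closed at $\hat a\in A$ if there is a neighbourhood $\mathcal V$ of $\hat a$ such that $A\cap\mathcal V$ is closed in $\mathcal V$. Proximal normal cone at $\hat a\in A$: $N^{\mathrm{prox}}_A(\hat a)=\{v\in H: \hat a\in\Pi_A(\hat a+\tau v)\text{ for some }\tau>0\}$. If $A$ is locally closed at $\hat a$, the limiting normal cone $N^{\mathrm{lim}}_A(\hat a)$ is the set of all $v\in H$ for which there are $a_n\in A$ and $v_n\in N^{\mathrm{prox}}_A(a_n)$ with $a_n\to\hat a$, $v_n\to v$. A non-empty set $A$, locally closed at $\hat a\in A$, is super-regular at $\hat a$ if for every $\varepsilon>0$ there is $\delta>0$ such that $A\cap\mathbb{B}_\delta(\hat a)$ is closed in $\mathbb{B}_\delta(\hat a)$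 and $\langle v,a'-a\rangle\le\varepsilon|v|\cdot|a'-a|$ for all $a,a'\in A\cap\mathbb{B}_\delta(\hat a)$ and $v\in N^{\mathrm{lim}}_A(a)$. Non-empty $A,B$, locally closed at $\bar x\in A\cap B$, intersect transversally at $\bar x$ if $-N^{\mathrm{lim}}_A(\bar x)\cap N^{\mathrm{lim}}_B(\bar x)=\{0\}$. Moreover, $\cos(A,B,\bar x)=\max\{\langle u,v\rangle: u\in -N^{\mathrm{lim}}_A(\bar x)\cap\overline{\mathbb B},\ v\in N^{\mathrm{lim}}_B(\bar x)\cap\overline{\mathbb B}\}\in[0,1]$; transversality at $\bar x$ is equivalent to $\cos(A,B,\bar x)<1$. Quasioptimal alternating projections (QAP) with constants $\sigma_A,\sigma_B\ge1$ started at $a_0\in A$: $b_{n+1}\in\Pi_B(a_n;\sigma_B)$, $a_{n+1}\in\Pi_A(b_{n+1};\sigma_A)$, $n\in\mathbb{N}_0$. ''The QAP converge to $\hat x$'' means: whatever choices of elements are made, the projections at each step are non-empty (the sequences are well-defined) and both $(a_n)$ and $(b_n)$ converge to $\hat x$ (which may depend on the choices). *)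

(* Defs.v *)
From HB Require Import structures.
From mathcomp Require Import all_boot all_order all_algebra.
From mathcomp Require Import all_classical all_reals all_analysis.

Set Implicit Arguments.
Unset Strict Implicit.
Unset Printing Implicit Defensive.

Import Order.TTheory GRing.Theory Num.Theory.
Import numFieldNormedType.Exports.

Local Open Scope classical_set_scope.
Local Open Scope ring_scope.

(* Positive definiteness of [inner] is a consequence of [inner_normE]; the
   topology is that of the norm, by the normed module structure. *)
HB.mixin Record NormedVector_isEuclidean (R : realType) H
    of NormedModule R H & Vector R H := {
  inner : H -> H -> R ;
  innerC : forall u v : H, inner u v = inner v u ;
  innerDl : forall u v w : H, inner (u + v) w = inner u w + inner v w ;
  innerZl : forall (k : R) (u v : H), inner (k *: u) v = k * inner u v ;
  inner_normE : forall u : H, inner u u = `|u| ^+ 2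
}.

#[short(type="euclideanType")]
HB.structure Definition Euclidean (R : realType) :=
  { H of NormedModule R H & Vector R H & NormedVector_isEuclidean R H }.

Section Euclidean.
Context {R : realType} {H : euclideanType R}.
Implicit Types (A B V : set H) (a x v : H).

Definition dist x A : R := inf [set `|x - a| | a in A].

Definition metric_proj A x : set H := [set a | A a /\ `|x - a| = dist x A].

Definition qmetric_proj (sigma : R) A x : set H :=
  [set a | A a /\ `|x - a| <= sigma * dist x A].

(* In [subspace V] the points outside [V] are isolated, so this is closedness of
   [A `&` V] in the relative topology of [V]. *)
Definition closed_in A V : Prop := closed (A `&` V : set (subspace V)).

Definition locally_closed A a : Prop :=
  exists V, [/\ open V, V a & closed_in A V].

Definition prox_normal A a : set H :=
  [set v | exists2 tau : R, 0 < tau & metric_proj A (a + tau *: v) a].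

Definition lim_normal A a : set H :=
  [set v | exists an vn : nat -> H,
    [/\ forall n, A (an n),
        forall n, prox_normal A (an n) (vn n),
        an @ \oo --> a
      & vn @ \oo --> v]].

Definition super_regular A x : Prop :=
  [/\ A !=set0, A x, locally_closed A x
    & forall eps : R, 0 < eps -> exists delta : R,
      [/\ 0 < delta,
          closed_in A (ball x delta)
        & forall a a' v,
            (A `&` ball x delta) a -> (A `&` ball x delta) a' ->
            lim_normal A a v ->
            inner v (a' - a) <= eps * `|v| * `|a' - a|]].

Definition intersect_transversally A B x : Prop :=
  (-%R @` lim_normal A x) `&` lim_normal B x = [set 0].

(* The set is nonempty and bounded, and the supremum is attained because the
   limiting normal cones are closed: it is a maximum. *)
Definition cos_angle A B x : R :=
  sup [set r | exists u v : H,
    [/\ (-%R @` lim_normal A x) u /\ `|u| <= 1,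
        lim_normal B x v /\ `|v| <= 1
      & r = inner u v]].

(* [b 0] plays no role: the second sequence starts at index 1. *)
Definition qap_step A B (sA sB : R) (a b : nat -> H) (n : nat) : Prop :=
  qmetric_proj sB B (a n) (b n.+1) /\ qmetric_proj sA A (b n.+1) (a n.+1).

Definition is_qap A B (sA sB : R) (a0 : H) (a b : nat -> H) : Prop :=
  a 0%N = a0 /\ forall n, qap_step A B sA sB a b n.

(* Whatever choices were made in the first [N] steps, the next two projections
   are nonempty. *)
Definition qap_well_defined A B (sA sB : R) (a0 : H) : Prop :=
  forall (N : nat) (a b : nat -> H),
    a 0%N = a0 -> (forall n, (n < N)%N -> qap_step A B sA sB a b n) ->
    qmetric_proj sB B (a N) !=set0 /\
    forall y, qmetric_proj sB B (a N) y -> qmetric_proj sA A y !=set0.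

End Euclidean.

(* Main.v *)
Require Import Defs.
From mathcomp Require Import all_boot all_order all_algebra.
From mathcomp Require Import all_classical all_reals all_analysis.
From mathcomp Require Import ring lra.

Set Implicit Arguments.
Unset Strict Implicit.
Unset Printing Implicit Defensive.

Import Order.TTheory GRing.Theory Num.Theory.
Import numFieldNormedType.Exports.

Local Open Scope classical_set_scope.
Local Open Scope ring_scope.

(** The theorem rests on one local estimate.  Let [c] exceed the cosine of the
    angle between [A] and [B] at [xbar].  Near [xbar], if [a] is in [A] and [b]
    is a nearest point of [B] to [a], then [dist b A <= c * `|a - b|]
    ([projection_contraction]).  To see this, let [y] be a nearest point of [A]
    to [b] and put [w := b - y].  Both [w] and [a - b] are proximal normals, to
    [A] at [y] and to [B] at [b], and
<<
      |w|^2 = <w, a - y> + <-w, a - b>.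
>>
    Super-regularity of [A] bounds the first term by an arbitrarily small
    multiple of [|w| |a - y|], while the angle bounds the second one by nearly
    [cos_angle A B xbar * |w| |a - b|].  The second bound holds at points near
    [xbar], and not only at [xbar], because proximal normals at nearby points
    accumulate at limiting normals at [xbar]; here the compactness of balls of a
    Euclidean space is used ([prox_normals_angle]).

    Hence, with [kappa := sA * c], one full step of the method multiplies the
    distance to [B] by at most [kappa]: the point [b n.+1] is at distance
    [dist (a n) B] from [a n], the point [a n.+1] is at distance at most
    [kappa * dist (a n) B] from [b n.+1], and [b n.+1] is in [B].  Consecutive
    points of [a] are therefore at most [(1 + kappa) * kappa ^+ n * dist a0 B]
    apart.  Summing this geometric bound shows by induction that the iterates
    stay in the region where the estimate applies and where nearest points exist
    ([qap_invariant]), and that [a] converges with the stated rate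
    ([geometric_limit]).  Local closedness puts the limit in [A] and in [B]. *)

(** * Compactness of Euclidean balls *)

Section Compactness.
Context {R : realType} {H : euclideanType R}.
Import VectorInternalTheory.

Lemma r2v_continuous : continuous (r2v : 'rV[R]_(dim H) -> H).
Proof.
have -> : (r2v : 'rV[R]__ -> H) =
    fun y => \sum_i y ord0 i *: r2v (delta_mx ord0 i : 'rV[R]__).
  apply/funext => y; rewrite [in LHS](row_sum_delta y) linear_sum.
  by apply: eq_bigr => i _; rewrite linearZ.
move=> y.
apply: (@cvg_big H _ +%R 0 xpredT (@add_continuous H) _ (nbhs y)) => i _.
by apply: cvgZr_tmp; exact: coord_continuous.
Qed.

(** Equivalence of norms: on the compact unit sphere of the coordinate space,
    the continuous positive function [y |-> `|r2v y|] has a positive minimum. *)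
Lemma r2v_lower_bound : exists2 m : R, 0 < m &
  forall y : 'rV[R]_(dim H), m * `|y| <= `|r2v y : H|.
Proof.
pose S := [set y : 'rV[R]_(dim H) | `|y| = 1].
have [S0|S0] := pselect (S !=set0); last first.
  exists 1 => // y; have [->|y0] := eqVneq y 0; first by rewrite normr0 mulr0.
  case: S0; exists (`|y|^-1 *: y); rewrite /S/= normrZ normfV normr_id mulVf//.
  by rewrite normr_eq0.
have Sc : compact S.
  apply: bounded_closed_compact.
    exists 1; split; first exact: real1.
    by move=> M M1 y /= ->; exact: ltW.
  apply: (@preimage_closed _ _ (fun y : 'rV[R]_(dim H) => `|y|)
    [set x | x = 1]).
    by move=> y _; exact: norm_continuous.
  exact: closed_eq.
have cN : continuous (fun y : 'rV[R]_(dim H) => `|r2v y : H|).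
  by move=> y; apply: (continuous_comp (@r2v_continuous y));
    exact: norm_continuous.
have [y0 y0S y0min] := compact_EVT_min S0 Sc (continuous_subspaceT cN).
rewrite inE in y0S.
exists `|r2v y0 : H|.
  rewrite normr_gt0; apply/eqP => /eqP.
  rewrite -(linear0 (r2v : _ -> H)) => /eqP /r2v_inj y00.
  by move: y0S; rewrite y00 /S/= normr0 => /esym/eqP; rewrite oner_eq0.
move=> y; have [->|y_neq0] := eqVneq y 0; first by rewrite normr0 mulr0.
have ygt : 0 < `|y| by rewrite normr_gt0.
have /y0min : `|y|^-1 *: y \in S.
  by rewrite inE /S/= normrZ normfV normr_id mulVf// gt_eqF.
by rewrite linearZ/= normrZ normfV normr_id ler_pdivlMl// mulrC.
Qed.

(** The ball is the image under the coordinate map of a closed set, which is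
    bounded by [r2v_lower_bound]. *)
Lemma euclidean_ball_compact (x : H) (r : R) :
  compact (closed_ball_ Num.norm x r).
Proof.
have [m m0 hm] := r2v_lower_bound.
have -> : closed_ball_ Num.norm x r =
    r2v @` ((r2v : 'rV[R]_(dim H) -> H) @^-1` closed_ball_ Num.norm x r).
  apply/seteqP; split=> [z hz|_ [y hy <-]//].
  by exists (v2r z); rewrite /preimage/= ?v2rK.
apply: continuous_compact; first exact/continuous_subspaceT/r2v_continuous.
apply: bounded_closed_compact.
  exists ((`|x| + r) / m); split; first exact: num_real.
  move=> M hM y hy; apply: le_trans (ltW hM).
  rewrite ler_pdivlMr// mulrC (le_trans (hm y))//.
  rewrite -[r2v y](subrK x) (le_trans (ler_normD _ _))// addrC lerD2l.
  by rewrite distrC.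
apply: preimage_closed; last exact: closed_closed_ball_.
by move=> y _; exact: r2v_continuous.
Qed.

(** The extracted indices are only required to satisfy [n <= f n], not to
    increase: this is all that convergence along [f] needs. *)
Lemma compact_subseq_cvg (K : set H) (u : nat -> H) :
  compact K -> (forall n, K (u n)) ->
  exists p (f : nat -> nat),
    [/\ K p, forall n, (n <= f n)%N & u \o f @ \oo --> p].
Proof.
move=> Kc Ku.
have uK : (u @ \oo) K by exists 0%N => // n _; exact: Ku.
have [p [Kp clp]] := Kc (u @ \oo) _ uK.
have near_p k : exists n, (k <= n)%N /\ `|p - u n| < k.+1%:R^-1.
  have [_ [[n /= kn <-] pn]] :
      (u @` [set n | (k <= n)%N]) `&` ball p (k.+1%:R^-1) !=set0.
    apply: clp; last by apply: nbhsx_ballx; rewrite invr_gt0.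
    by exists k => // n /= kn; exists n.
  by exists n; split => //; move: pn; rewrite -ball_normE.
have [f hf] := choice near_p.
exists p, f; split => [//|n|]; first by case: (hf n).
apply/cvgrPdist_lt => e e0.
near=> n; have [_ h] := hf n; apply: lt_trans h _.
near: n; exact: near_infty_natSinv_lt (PosNum e0).
Unshelve. all: by end_near.
Qed.

Lemma cvg_subseq (z : nat -> H) (f : nat -> nat) (p : H) :
  (forall n, (n <= f n)%N) -> z @ \oo --> p -> z (f n) @[n --> \oo] --> p.
Proof.
move=> fge zp V /zp [N _ hN]; exists N => // n /= Nn.
by apply: hN => /=; exact: leq_trans (fge n).
Qed.

End Compactness.

(** * Inner product *)

Section AlternatingProjections.
Context {R : realType} {H : euclideanType R}.
Implicit Types (A B K : set H) (a b p u v x y : H).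

Lemma innerNl u v : inner (- u) v = - inner u v.
Proof. by rewrite -scaleN1r innerZl mulN1r. Qed.

Lemma inner0l v : inner 0 v = 0.
Proof. by rewrite -(scale0r (0 : H)) innerZl mul0r. Qed.

Lemma inner_polarization u v :
  inner u v = 2^-1 * (`|u + v| ^+ 2 - `|u| ^+ 2 - `|v| ^+ 2).
Proof.
rewrite -!inner_normE innerDl [inner u (u + v)]innerC [inner v (u + v)]innerC.
rewrite !innerDl [inner v u]innerC; lra.
Qed.

(** Cauchy-Schwarz is the triangle inequality for [u + v], squared. *)
Lemma inner_le_norm u v : inner u v <= `|u| * `|v|.
Proof.
have h : `|u + v| ^+ 2 <= (`|u| + `|v|) ^+ 2.
  by rewrite lerXn2r ?nnegrE ?addr_ge0// ler_normD.
rewrite inner_polarization; nra.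
Qed.

Lemma cvg_inner (un vn : nat -> H) u v : un @ \oo --> u -> vn @ \oo --> v ->
  inner (un n) (vn n) @[n --> \oo] --> inner u v.
Proof.
move=> hu hv.
have sq (wn : nat -> H) w : wn @ \oo --> w ->
    `|wn n| ^+ 2 @[n --> \oo] --> `|w| ^+ 2.
  move=> hw; rewrite expr2; under eq_fun do rewrite expr2.
  by apply: cvgM; exact: cvg_norm.
rewrite inner_polarization; under eq_fun do rewrite inner_polarization.
apply: cvgM; first exact: cvg_cst.
apply: cvgB; last exact: sq.
by apply: cvgB; apply: sq => //; exact: cvgD.
Qed.

(** * Distances, projections and proximal normals *)

Lemma dist_ge0 x A : 0 <= dist x A.
Proof.
have [[a Aa]|A0] := pselect (A !=set0).
  by rewrite /dist; apply: lb_le_inf; [exists `|x - a|, a|move=> _ [y _ <-]].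
rewrite /dist; suff -> : [set `|x - a| | a in A] = set0 by rewrite inf0.
by rewrite -subset0 => r [a Aa _]; apply: A0; exists a.
Qed.

Lemma dist_le x A a : A a -> dist x A <= `|x - a|.
Proof.
have lb : has_lbound [set `|x - a| | a in A] by exists 0 => _ [y _ <-].
by move=> Aa; apply: (ge_inf lb); exists a.
Qed.

Lemma metric_projP A x a :
  metric_proj A x a <-> A a /\ forall a', A a' -> `|x - a| <= `|x - a'|.
Proof.
split=> [[Aa eqd]|[Aa mina]]; split => //.
  by move=> a' Aa'; rewrite eqd dist_le.
apply/eqP; rewrite eq_le dist_le// andbT lb_le_inf//; first by exists `|x - a|, a.
by move=> _ [a' Aa' <-]; exact: mina.
Qed.

Lemma qmetric_proj1 A : qmetric_proj 1 A = metric_proj A.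
Proof.
apply/funext => x; apply/seteqP; split=> a [Aa h]; split=> //.
  by apply/eqP; rewrite eq_le dist_le// andbT -[leRHS]mul1r.
by rewrite mul1r; move: (lexx (dist x A)); rewrite -{1}h.
Qed.

Lemma sub_qmetric_proj (s : R) A x :
  1 <= s -> metric_proj A x `<=` qmetric_proj s A x.
Proof.
move=> s1 a; rewrite -qmetric_proj1 => -[Aa h]; split => //; apply: le_trans h _.
by rewrite ler_wpM2r ?dist_ge0.
Qed.

(** Points of [A] farther than [r] from [p] cannot be nearer to [x] than [p] is,
    so the distance may be minimised over a compact part of [A]. *)
Lemma metric_proj_exists A p x (r : R) : A p ->
  closed (A `&` closed_ball_ Num.norm p r) -> `|x - p| <= r / 2 ->
  metric_proj A x !=set0.
Proof.
move=> Ap Acl xp; pose K := A `&` closed_ball_ Num.norm p r.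
have Kc : compact K.
  by apply: (subclosed_compact Acl (@euclidean_ball_compact R H p r)) => y [].
have r0 : 0 <= r by have := normr_ge0 (x - p); lra.
have Kp : K p by split => //; rewrite /closed_ball_/= subrr normr0.
have cd : continuous (fun y => `|x - y|).
  by move=> y; apply: cvg_norm; apply: cvgB; [exact: cvg_cst|exact: cvg_id].
have [y /set_mem[Ay _] miny] :=
  compact_EVT_min (ex_intro _ p Kp) Kc (continuous_subspaceT cd).
exists y; apply/metric_projP; split => // a Aa.
have [pa|pa] := leP `|p - a| r; first by apply: miny; rewrite inE.
have /miny xyp : p \in K by rewrite inE.
have := ler_distD x p a; rewrite (distrC p x); lra.
Qed.

Lemma prox_normal_proj A x a : metric_proj A x a -> prox_normal A a (x - a).
Proof. by move=> h; exists 1 => //; rewrite scale1r addrC subrK. Qed.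

Lemma prox_normalZ A a v (k : R) :
  0 < k -> prox_normal A a v -> prox_normal A a (k *: v).
Proof.
move=> k0 [t t0 h]; exists (t / k); first by rewrite divr_gt0.
by rewrite scalerA divfK ?gt_eqF.
Qed.

Lemma prox_lim_normal A a v : A a -> prox_normal A a v -> lim_normal A a v.
Proof.
by move=> Aa h; exists (fun=> a), (fun=> v); split => //; exact: cvg_cst.
Qed.

Lemma prox_normal0 A a : A a -> prox_normal A a 0.
Proof.
move=> Aa; have := @prox_normal_proj A a a; rewrite subrr; apply.
by apply/metric_projP; split => // a' _; rewrite subrr normr0.
Qed.

Lemma locally_closed_ball A x : locally_closed A x ->
  exists2 r : R, 0 < r &
    forall s, s <= r -> closed (A `&` closed_ball_ Num.norm x s).
Proof.
move=> [V [Vo Vx /closed_subspaceP[C Ccl CV]]].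
have /nbhs_ballP[e /= e0 eV] := open_nbhs_nbhs (conj Vo Vx).
exists (e / 2); first by rewrite divr_gt0.
move=> s se.
have sV : closed_ball_ Num.norm x s `<=` V.
  move=> y xy; apply: eV; rewrite -ball_normE/=; rewrite /closed_ball_/= in xy; lra.
rewrite (_ : _ `&` _ = C `&` closed_ball_ Num.norm x s).
  by apply: closedI => //; exact: closed_closed_ball_.
apply/seteqP; split=> y [hy xy]; split => //; have yV := sV _ xy.
  by have [] : (C `&` V) y by rewrite CV.
by have [[]] : (A `&` V `&` V) y by rewrite -CV.
Qed.

(** * The angle between the normal cones near the common point *)

Lemma cos_angle_ub A B x u v : lim_normal A x u -> lim_normal B x v ->
  `|u| <= 1 -> `|v| <= 1 -> inner (- u) v <= cos_angle A B x.
Proof.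
move=> uA vB u1 v1; rewrite /cos_angle; apply: ub_le_sup; last first.
  by exists (- u), v; split => //; rewrite normrN; split => //; exists u.
exists 1 => _ [u' [v' [[_ u'1] [_ v'1] ->]]].
by apply: le_trans (inner_le_norm _ _) _; rewrite -[leRHS]mul1r ler_pM.
Qed.

Lemma cos_angle_ge0 A B x : A x -> B x -> 0 <= cos_angle A B x.
Proof.
move=> Ax Bx; apply: le_trans (@cos_angle_ub _ _ x 0 0 _ _ _ _); rewrite ?normr0//.
- by rewrite oppr0 inner0l.
- exact/prox_lim_normal/prox_normal0.
- exact/prox_lim_normal/prox_normal0.
Qed.

(** If the bound failed at points arbitrarily close to [x], unit proximal
    normals violating it would accumulate at limiting normals at [x] with inner
    product at least [c], more than [cos_angle A B x] allows. *)
Lemma prox_normals_angle A B x (c : R) : cos_angle A B x < c -> 0 <= c ->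
  exists2 r : R, 0 < r & forall a b u v, A a -> B b ->
    `|x - a| < r -> `|x - b| < r -> prox_normal A a u -> prox_normal B b v ->
    inner (- u) v <= c * (`|u| * `|v|).
Proof.
move=> cosc c0; apply: contrapT => no_r.
have bad (n : nat) : exists w : (H * H) * (H * H),
    [/\ A w.1.1 /\ B w.1.2,
        `|x - w.1.1| < n.+1%:R^-1 /\ `|x - w.1.2| < n.+1%:R^-1,
        prox_normal A w.1.1 w.2.1 /\ prox_normal B w.1.2 w.2.2,
        `|w.2.1| = 1 /\ `|w.2.2| = 1
      & c < inner (- w.2.1) w.2.2].
  apply: contrapT => no_w; apply: no_r; exists n.+1%:R^-1; first by rewrite invr_gt0.
  move=> a b u v Aa Bb xa xb ua vb; rewrite leNgt; apply/negP => hc.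
  have [u0|u0] := eqVneq u 0.
    by move: hc; rewrite u0 oppr0 inner0l normr0 mul0r mulr0 ltxx.
  have [v0|v0] := eqVneq v 0.
    by move: hc; rewrite v0 innerC inner0l normr0 !mulr0 ltxx.
  have {}u0 : 0 < `|u| by rewrite normr_gt0.
  have {}v0 : 0 < `|v| by rewrite normr_gt0.
  apply: no_w; exists ((a, b), (`|u|^-1 *: u, `|v|^-1 *: v)); split => //=.
  - by split; apply: prox_normalZ; rewrite ?invr_gt0.
  - by rewrite !normrZ !normfV !normr_id !mulVf// gt_eqF.
  - rewrite -scalerN innerZl innerC innerZl innerC mulrA -invfM.
    by rewrite mulrC ltr_pdivlMr// mulr_gt0.
have [w hw] := choice bad.
pose K := closed_ball_ Num.norm (0 : H) 1.
have Kc : compact K by exact: (@euclidean_ball_compact R H).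
have K1 z : `|z| = 1 -> K z by rewrite /K/closed_ball_/= sub0r normrN => ->.
have w1K n : K (w n).2.1 by apply: K1; have [_ _ _ []] := hw n.
have w2K n : K (w n).2.2 by apply: K1; have [_ _ _ []] := hw n.
have [u [f [Ku fge uf]]] := compact_subseq_cvg Kc w1K.
have [v [g [Kv gge vg]]] := compact_subseq_cvg Kc (fun n => w2K (f n)).
have fgge n : (n <= f (g n))%N by exact: leq_trans (gge n) (fge _).
have ug : (w (f (g n))).2.1 @[n --> \oo] --> u by exact: (cvg_subseq gge uf).
have inv_bound (z : nat -> H) :
    (forall n, `|x - z n| < n.+1%:R^-1) -> z (f (g n)) @[n --> \oo] --> x.
  move=> hz; apply/cvgrPdist_lt => e e0; near=> n.
  apply: lt_trans (hz _) _; apply: (@le_lt_trans _ _ n.+1%:R^-1).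
    by rewrite lef_pV2 ?posrE// ler_nat ltnS.
  near: n; exact: near_infty_natSinv_lt (PosNum e0).
have ulim : lim_normal A x u.
  exists (fun n => (w (f (g n))).1.1), (fun n => (w (f (g n))).2.1); split => //.
  - by move=> n; have [[]] := hw (f (g n)).
  - by move=> n; have [_ _ []] := hw (f (g n)).
  - by apply: (inv_bound (fun n => (w n).1.1)) => n; have [_ []] := hw n.
have vlim : lim_normal B x v.
  exists (fun n => (w (f (g n))).1.2), (fun n => (w (f (g n))).2.2); split => //.
  - by move=> n; have [[]] := hw (f (g n)).
  - by move=> n; have [_ _ []] := hw (f (g n)).
  - by apply: (inv_bound (fun n => (w n).1.2)) => n; have [_ []] := hw n.
have Knorm z : K z -> `|z| <= 1 by rewrite /K/closed_ball_/= sub0r normrN.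
have := cos_angle_ub ulim vlim (Knorm _ Ku) (Knorm _ Kv).
apply/negP; rewrite -ltNge; apply: lt_le_trans cosc _.
have cvi : inner (- (w (f (g n))).2.1) (w (f (g n))).2.2
    @[n --> \oo] --> inner (- u) v.
  by apply: cvg_inner => //; exact: cvgN.
rewrite leNgt; apply/negP => cvi_lt.
have [N _ hN] := cvgr_lt _ cvi _ cvi_lt.
have := hN N (leqnn N); have [_ _ _ _ hw5] := hw (f (g N)).
by move/(lt_trans hw5); rewrite ltxx.
Unshelve. all: by end_near.
Qed.

(** * Contraction and linear convergence *)

Definition contracts_near A B x (c r : R) :=
  forall a b, A a -> metric_proj B a b ->
    `|x - a| < r -> `|x - b| < r -> dist b A <= c * `|a - b|.

(** With [w := b - y], where [y] is a nearest point of [A] to [b], the identity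
    [|w|^2 = <w, a - y> + <-w, a - b>] is bounded through super-regularity and
    the angle.  As [a] competes with [y], [|w| <= |a - b|], whence
    [|a - y| <= 2 * |a - b|] in the super-regularity term. *)
Lemma projection_contraction A B x (c : R) :
  A x -> B x -> super_regular A x -> cos_angle A B x < c ->
  exists2 r : R, 0 < r & contracts_near A B x c r.
Proof.
move=> Ax Bx [_ _ Alc sr] cosc; set c0 := cos_angle A B x in cosc.
have c00 : 0 <= c0 by exact: cos_angle_ge0.
(* The slack between [c0] and [c] is shared: [c1 + 2 * e = c]. *)
pose c1 := (c0 + c) / 2; pose e := (c - c0) / 4.
have [r0 r0_gt0 angle] : exists2 r : R, 0 < r & forall a b u v, A a -> B b ->
    `|x - a| < r -> `|x - b| < r -> prox_normal A a u -> prox_normal B b v ->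
    inner (- u) v <= c1 * (`|u| * `|v|).
  by apply: prox_normals_angle; rewrite /c1 -/c0; lra.
have e0 : 0 < e by rewrite /e; lra.
have [d [d0 _ {}sr]] := sr _ e0.
have [rho rho0 Acl] := locally_closed_ball Alc.
pose s := Num.min r0 (Num.min d rho).
have s0 : 0 < s by rewrite !lt_min r0_gt0 d0.
have [sr0 sd srho] : [/\ s <= r0, s <= d & s <= rho] by rewrite !ge_min !lexx !orbT.
(* Halving the radius keeps [y], the projection of [b], within [s] of [x]. *)
exists (s / 2) => [|a b Aa ab xa xb]; first by rewrite divr_gt0.
have [Bb _] := ab.
have [y by_] : metric_proj A b !=set0.
  by apply: (metric_proj_exists Ax (Acl _ srho)); rewrite distrC ltW.
have /metric_projP[Ay miny] := by_.
apply: le_trans (dist_le b Ay) _.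
have xy : `|x - y| < s.
  have := ler_distD b x y; have := miny _ Ax; rewrite (distrC b x); lra.
have nA : prox_normal A y (b - y) by exact: prox_normal_proj.
have nB : prox_normal B b (a - b) by exact: prox_normal_proj.
have h1 : inner (- (b - y)) (a - b) <= c1 * (`|b - y| * `|a - b|).
  by apply: angle nA nB => //; lra.
have h2 : inner (b - y) (a - y) <= e * `|b - y| * `|a - y|.
  apply: sr; last exact: prox_lim_normal.
    by split => //; rewrite -ball_normE /=; lra.
  by split => //; rewrite -ball_normE /=; lra.
have wa : `|b - y| <= `|a - b| by rewrite (distrC a b); exact: miny.
have tri : `|a - y| <= `|a - b| + `|b - y| by exact: ler_distD.
have split_w : `|b - y| ^+ 2 =
    inner (b - y) (a - y) + inner (- (b - y)) (a - b).
  have -> : `|b - y| ^+ 2 = inner ((a - y) - (a - b)) (b - y).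
    by rewrite -inner_normE opprB [a - y + _]addrC addrA subrK.
  by rewrite innerDl !innerNl [inner (a - y) _]innerC [inner (a - b) _]innerC.
have [w0|w0] := eqVneq `|b - y| 0.
  by rewrite w0 mulr_ge0//; lra.
have {}w0 : 0 < `|b - y| by rewrite lt_neqAle eq_sym w0 normr_ge0.
rewrite -(ler_pM2l w0) -expr2 split_w.
have h3 : e * `|b - y| * `|a - y| <= e * `|b - y| * (2 * `|a - b|).
  by rewrite ler_wpM2l ?mulr_ge0// ?(ltW e0)//; lra.
rewrite /c1 /e in h1 h2 h3; lra.
Qed.

(** Compactness gives a subsequential limit, and the geometric bound on
    [z m - z n], for [m] at least [n], passes to it. *)
Lemma geometric_limit K (z : nat -> H) (C k : R) : compact K ->
  (forall n, K (z n)) -> 0 <= k < 1 ->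
  (forall n, `|z n.+1 - z n| <= C * k ^+ n) ->
  exists2 p, K p & forall n, `|p - z n| <= C / (1 - k) * k ^+ n.
Proof.
move=> Kc Kz /andP[k0 k1] hz.
have C0 : 0 <= C by have := hz 0%N; rewrite expr0 mulr1; apply: le_trans.
have tail n m : (1 - k) * `|z (n + m)%N - z n| <= C * k ^+ n * (1 - k ^+ m).
  elim: m => [|m IH]; first by rewrite addn0 subrr normr0 expr0 subrr !mulr0.
  have := ler_distD (z (n + m)%N) (z (n + m).+1) (z n).
  have := hz (n + m)%N; rewrite addnS exprS exprD => h1 h2.
  have : (1 - k) * `|z (n + m).+1 - z n| <=
      (1 - k) * (C * (k ^+ n * k ^+ m) + `|z (n + m)%N - z n|).
    by rewrite ler_wpM2l ?subr_ge0 ?(ltW k1)//; lra.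
  lra.
have [p [f [Kp fge fp]]] := compact_subseq_cvg Kc Kz.
exists p => // n; rewrite mulrAC ler_pdivlMr ?subr_gt0// mulrC.
apply/ler_addgt0Pr => e e0.
move/cvgrPdist_lt : fp => /(_ e e0)[N _ hN].
have := hN (maxn N n) (leq_maxl _ _) => /=.
set j := f _; have nj : (n <= j)%N by exact: leq_trans (leq_maxr N n) (fge _).
move=> pj; have := tail n (j - n)%N; rewrite subnKC// => tj.
have kj : 0 <= C * k ^+ n * k ^+ (j - n) by rewrite !mulr_ge0 ?exprn_ge0.
have := ler_distD (z j) p (z n) => tri.
have : (1 - k) * `|p - z n| <= (1 - k) * (`|p - z j| + `|z j - z n|).
  by rewrite ler_wpM2l ?subr_ge0 ?(ltW k1).
have : (1 - k) * `|p - z j| <= `|p - z j| by rewrite ler_piMl//; lra.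
lra.
Qed.

Lemma geometric_cvg (z : nat -> H) p (C k : R) : 0 <= k < 1 ->
  (forall n, `|p - z n| <= C * k ^+ n) -> z @ \oo --> p.
Proof.
move=> /andP[k0 k1] hz; apply/cvgrPdist_lt => e e0.
have := cvg_geometric C (_ : `|k| < 1); rewrite ger0_norm// => /(_ k1) hg.
have [N _ hN] := cvgr_lt _ hg _ e0.
by exists N => // n /= Nn; apply: le_lt_trans (hz n) (hN n Nn).
Qed.

(** The second projection is only quasioptimal, so the contraction factor [c] is
    degraded to [sA * c]. *)
Lemma qap_step_bounds A B x (c sA delta : R) (a b : nat -> H) n :
  contracts_near A B x c delta ->
  0 <= c -> 0 <= sA -> B x -> A (a n) -> `|x - a n| < delta / 2 ->
  qap_step A B sA 1 a b n ->
  [/\ A (a n.+1), `|x - b n.+1| < delta, `|a n - b n.+1| <= dist (a n) B &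
      `|b n.+1 - a n.+1| <= sA * c * dist (a n) B].
Proof.
move=> dec c0 sA0 Bx Aan xa [hb [Aan1 ha]].
have [Bb hb1] := hb; rewrite mul1r in hb1.
have hp : metric_proj B (a n) (b n.+1) by rewrite -qmetric_proj1.
have dx := dist_le (a n) Bx.
have xb : `|x - b n.+1| < delta.
  have := ler_distD (a n) x (b n.+1); rewrite (distrC (a n) x) in dx; lra.
split => //; apply: le_trans ha _; rewrite -mulrA ler_wpM2l//.
apply: le_trans (dec _ _ Aan hp _ xb) _; last by rewrite ler_wpM2l.
have := normr_ge0 (x - a n); lra.
Qed.

(** The radius of the theorem: with [d] the initial distance to [B], the orbit
    travels at most [2 * d / (1 - k)], which is less than [delta / 4], and the
    starting point is within [delta / 8] of [x]. *)
Lemma near_of_start x (k delta d : R) a0 a : 0 <= k < 1 -> 0 < delta ->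
  d <= `|a0 - x| -> `|a0 - x| < (1 - k) / 8 * delta ->
  (1 - k) * `|a - a0| <= 2 * d -> `|x - a| < 3 / 8 * delta.
Proof.
move=> /andP[k0 k1] delta0 dx xa0 aa0; have k1' : 0 < 1 - k by lra.
rewrite -(ltr_pM2l k1').
have : (1 - k) * `|x - a| <= (1 - k) * (`|a - a0| + `|a0 - x|).
  by rewrite ler_wpM2l ?(ltW k1')// (distrC x a); exact: ler_distD.
have : (1 - k) * `|a0 - x| <= `|a0 - x| by rewrite ler_piMl//; lra.
lra.
Qed.

(** Only the steps before [N] are assumed, so that the result also applies to
    the finite runs that appear in well-definedness. *)
Lemma qap_invariant A B x (c sA delta : R) (a b : nat -> H) N :
  contracts_near A B x c delta ->
  0 <= c -> 0 <= sA -> sA * c < 1 -> 0 < delta -> B x -> A (a 0%N) ->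
  `|a 0%N - x| < (1 - sA * c) / 8 * delta ->
  (forall n, (n < N)%N -> qap_step A B sA 1 a b n) ->
  forall n, (n <= N)%N ->
  [/\ A (a n), `|x - a n| < 3 / 8 * delta &
      dist (a n) B <= (sA * c) ^+ n * dist (a 0%N) B].
Proof.
move=> dec c0 sA0; set k := sA * c => k1 delta0 Bx Aa0 xa0 steps.
have k0 : 0 <= k by rewrite mulr_ge0.
have d0 := dist_ge0 (a 0%N) B; set d := dist (a 0%N) B in d0 *.
have near_start n : (1 - k) * `|a n - a 0%N| <= (1 + k) * (1 - k ^+ n) * d ->
    `|x - a n| < 3 / 8 * delta.
  move=> h; apply: (@near_of_start x k delta d (a 0%N)) => //.
  - by rewrite k0.
  - exact: dist_le.
  apply: le_trans h _; rewrite ler_wpM2r//.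
  have kn : 0 <= k ^+ n by rewrite exprn_ge0.
  by apply: (@le_trans _ _ ((1 + k) * 1)); [rewrite ler_wpM2l; lra|lra].
(* The bound on the total displacement is a partial geometric sum, multiplied
   by [1 - k]. *)
suff inv n : (n <= N)%N -> [/\ A (a n), dist (a n) B <= k ^+ n * d &
    (1 - k) * `|a n - a 0%N| <= (1 + k) * (1 - k ^+ n) * d].
  by move=> n /inv[An dn /near_start xn].
elim: n => [_|n IH nN].
  by rewrite expr0 mul1r !subrr normr0 !mulr0 mul0r.
have [An dn an] := IH (ltnW nN).
have xn : `|x - a n| < delta / 2 by have := near_start _ an; lra.
have [An1 _ ab ba] := qap_step_bounds dec c0 sA0 Bx An xn (steps _ nN).
rewrite -/k in ba.
have Bb : B (b n.+1) by have [[]] := steps _ nN.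
have kd : k * dist (a n) B <= k ^+ n.+1 * d.
  by rewrite exprS -mulrA ler_wpM2l.
split => //.
  by apply: le_trans (dist_le _ Bb) _; rewrite distrC; lra.
have h : `|a n.+1 - a 0%N| <= (1 + k) * (k ^+ n * d) + `|a n - a 0%N|.
  have := ler_distD (a n) (a n.+1) (a 0%N).
  have := ler_distD (b n.+1) (a n.+1) (a n).
  rewrite (distrC (a n.+1) (b n.+1)) (distrC (b n.+1) (a n)).
  rewrite exprS -mulrA in kd; lra.
have : (1 - k) * `|a n.+1 - a 0%N| <=
    (1 - k) * ((1 + k) * (k ^+ n * d) + `|a n - a 0%N|).
  by rewrite ler_wpM2l//; lra.
rewrite exprS; lra.
Qed.

End AlternatingProjections.

(** * Local linear convergence *)

Theorem theorem6p3 (R : realType) (H : euclideanType R) (A B : set H)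
    (xbar : H) (cbar : R)
    (hA0 : A !=set0) (hB0 : B !=set0) (hx : (A `&` B) xbar)
    (hAcl : locally_closed A xbar) (hBcl : locally_closed B xbar)
    (htr : intersect_transversally A B xbar)
    (hcos : cos_angle A B xbar = cbar) (hcbar : cbar < 1)
    (hAsr : super_regular A xbar) :
  forall c : R, cbar < c -> c < 1 ->
  exists2 delta : R, 0 < delta &
  forall (sA : R) (a0 : H), let kappa := sA * c in
    1 <= sA -> kappa < 1 ->
    A a0 -> `|a0 - xbar| < (1 - kappa) / 8%:R * delta ->
    qap_well_defined A B sA 1 a0 /\
    forall a b : nat -> H, is_qap A B sA 1 a0 a b ->
    exists xhat : H,
      [/\ a @ \oo --> xhat /\ b @ \oo --> xhat,
          (A `&` B) xhat,
          `|xhat - xbar| < 3%:R / 8%:R * delta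
        & forall n : nat,
            `|xhat - a n| <= (1 + kappa) / (1 - kappa) * kappa ^+ n * dist a0 B /\
            `|xhat - b n.+1| <= 2%:R * kappa / (1 - kappa) * kappa ^+ n * dist a0 B].
Proof.
move=> c; rewrite -hcos => cosc c1.
have [Ax Bx] := hx.
have c0 : 0 <= c by apply: le_trans (ltW cosc); exact: cos_angle_ge0.
have [r r0 dec_r] := projection_contraction Ax Bx hAsr cosc.
have [rA rA0 Acl] := locally_closed_ball hAcl.
have [rB rB0 Bcl] := locally_closed_ball hBcl.
pose s := Num.min r (Num.min rA rB).
have s0 : 0 < s by rewrite !lt_min r0 rA0.
have [sr sA sB] : [/\ s <= r, s <= rA & s <= rB] by rewrite !ge_min !lexx !orbT.
(* Projections onto a set closed in the ball of radius [s] exist for points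
   within [s / 2] of the centre. *)
exists (s / 2) => [|lam a0 k lam1 k1 Aa0 xa0]; first by rewrite divr_gt0.
have {}sr : s / 2 <= r by lra.
have {sr r0}dec : contracts_near A B xbar c (s / 2).
  by move=> a b Aa ab xa xb; apply: dec_r => //; lra.
have lam0 : 0 <= lam by lra.
have k0 : 0 <= k by rewrite mulr_ge0.
have k01 : 0 <= k < 1 by rewrite k0.
have delta0 : 0 < s / 2 by rewrite divr_gt0.
have proj_near E y : E xbar -> closed (E `&` closed_ball_ Num.norm xbar s) ->
    `|xbar - y| < s / 2 -> metric_proj E y !=set0.
  by move=> Ex Ecl xy; apply: (metric_proj_exists Ex Ecl); rewrite distrC ltW.
split=> [N a b a00 steps|a b [a00 steps]].
  rewrite -a00 in Aa0 xa0.
  have [AN xN _] :=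
    qap_invariant dec c0 lam0 k1 delta0 Bx Aa0 xa0 steps (leqnn N).
  have xaN : `|xbar - a N| < s / 2 by lra.
  split=> [|y].
    by rewrite qmetric_proj1; apply: proj_near => //; exact: Bcl.
  rewrite qmetric_proj1 => /metric_projP[_ miny].
  have [z Az] : metric_proj A y !=set0.
    apply: proj_near => //; first exact: Acl.
    have := miny _ Bx; have := ler_distD (a N) xbar y.
    rewrite (distrC (a N) xbar); lra.
  by exists z; exact: sub_qmetric_proj.
rewrite -a00 in Aa0 xa0 *.
have inv n := qap_invariant dec c0 lam0 k1 delta0 Bx Aa0 xa0
  (fun m _ => steps m) (leqnn n).
have step n : [/\ A (a n.+1), `|xbar - b n.+1| < s / 2,
    `|a n - b n.+1| <= dist (a n) B & `|b n.+1 - a n.+1| <= k * dist (a n) B].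
  have [An xn _] := inv n.
  by apply: (qap_step_bounds dec c0 lam0 Bx An _ (steps n)); lra.
set d := dist (a 0%N) B.
have d0 : 0 <= d := dist_ge0 _ _.
pose K := A `&` closed_ball_ Num.norm xbar s.
have Kc : compact K.
  apply: (subclosed_compact (Acl _ sA) (@euclidean_ball_compact R H xbar s)).
  by move=> y [].
have aK n : K (a n).
  by have [An xn _] := inv n; split => //; rewrite /closed_ball_/=; lra.
have gap n : `|a n.+1 - a n| <= (1 + k) * d * k ^+ n.
  have [_ _ ab ba] := step n; have [_ _ dn] := inv n.
  have := ler_distD (b n.+1) (a n.+1) (a n).
  rewrite (distrC (a n.+1) (b n.+1)) (distrC (b n.+1) (a n)).
  have : k * dist (a n) B <= k * (k ^+ n * d) by rewrite ler_wpM2l.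
  rewrite -/k -/d in dn; lra.
have [p [Ap _] pa] := geometric_limit Kc aK k01 gap.
have pb n : `|p - b n.+1| <= 2 * k / (1 - k) * d * k ^+ n.
  have [_ _ _ ba] := step n; have [_ _ dn] := inv n.
  have kd : k * dist (a n) B <= k * (k ^+ n * d) by rewrite ler_wpM2l.
  have := ler_distD (a n.+1) p (b n.+1); have := pa n.+1.
  rewrite (distrC (a n.+1) (b n.+1)) exprS => h1 h2.
  apply: (@le_trans _ _ ((1 + k) * d / (1 - k) * (k * k ^+ n) + k * (k ^+ n * d))).
    by lra.
  rewrite le_eqVlt; apply/orP; left; apply/eqP; field.
  by rewrite gt_eqF// subr_gt0.
have bS : b n.+1 @[n --> \oo] --> p by exact: (geometric_cvg k01 pb).
have b_cvg : b @ \oo --> p by rewrite -cvg_shiftS.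
exists p; split.
- by split => //; exact: (geometric_cvg k01 pa).
- split => //.
  have : (B `&` closed_ball_ Num.norm xbar s) p; last by case.
  apply: (closed_cvg _ (Bcl _ sB) _ _ bS).
  exists 0%N => // n _; have [_ xb _ _] := step n; have [[Bb _] _] := steps n.
  by split => //; rewrite /closed_ball_/=; lra.
- rewrite distrC; apply: (@near_of_start _ _ xbar k (s / 2) d (a 0%N)) => //.
    exact: dist_le.
  have := pa 0%N; rewrite expr0 mulr1 ler_pdivlMr ?subr_gt0// => h.
  rewrite mulrC; apply: le_trans h _; rewrite ler_wpM2r//; lra.
- move=> n; split.
    by have := pa n; lra.
  by have := pb n; lra.
Qed.
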